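(* OPEN PACKING is polynomial time solvable on $K_{1,3}$-free split graphs.
   Context: All graphs are finite, simple and undirected. For a graph $G$ and $x\in V(G)$, $N_G(x)$ is the set of neighbours of $x$. A vertex subset $S$ of $G$ is an open packing if $N_G(x)\cap N_G(y)=\emptyset$ for every pair of distinct $x,y\in S$. OPEN PACKING: given a graph $G$ and a positive integer $k\leq |V(G)|$, decide whether $G$ has an open packing of size at least $k$. A split graph is a graph whose vertex set can be partitioned into a clique and an independent set. A graph is $K_{1,3}$-free if it has no induced subgraph isomorphic to $K_{1,3}$. *)

(* Defs.v *)
From HB Require Import structures.
From mathcomp Require Import all_boot all_order all_algebra.

Set Implicit Arguments.
Unset Strict Implicit.
Unset Printing Implicit Defensive.

Record sgraph (T : finType) := SGraph {
  adj :> rel T;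
  adj_sym : symmetric adj;
  adj_irr : irreflexive adj
}.

Section Graphs.
Variables (T : finType) (G : sgraph T).
Implicit Types (S C : {set T}) (x : T).

Definition nbhd x : {set T} := [set y | G x y].

Definition open_packing S : Prop :=
  {in S &, forall x y, x != y -> nbhd x :&: nbhd y = set0}.

Definition clique C : Prop := {in C &, forall x y, x != y -> G x y}.

Definition independent S : Prop := {in S &, forall x y, ~~ G x y}.

Definition split_graph : Prop :=
  exists C : {set T}, clique C /\ independent (~: C).

Definition has_induced (U : finType) (H : sgraph U) : Prop :=
  exists f : U -> T, injective f /\ forall u v, G (f u) (f v) = H u v.

End Graphs.

Definition biclique_adj (m n : nat) : rel ('I_m + 'I_n) :=
  fun x y => match x, y with
             | inl _, inr _ | inr _, inl _ => true
             | _, _ => false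
             end.

Lemma biclique_sym m n : symmetric (@biclique_adj m n).
Proof. by case=> ? []. Qed.

Lemma biclique_irr m n : irreflexive (@biclique_adj m n).
Proof. by case. Qed.

Definition biclique (m n : nat) : sgraph ('I_m + 'I_n)%type :=
  SGraph (@biclique_sym m n) (@biclique_irr m n).

Definition claw_free (T : finType) (G : sgraph T) : Prop :=
  ~ has_induced G (biclique 1 3).

(* Deterministic Turing machines with finitely many (at least one) two-way
   infinite tapes. The tape alphabet is the binary input alphabet together with
   the auxiliary symbols [aux] and the blank, which is [None]. A state [q] with
   [verdict q = Some b] is halting, with answer [b]. *)
Inductive direction := MoveLeft | Stay | MoveRight.

Definition symbol (aux : finType) : finType := option (bool + aux)%type.

Record machine := Machine {
  extra_tapes : nat;
  aux : finType;
  state : finType;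
  start : state;
  verdict : state -> option bool;
  delta : state -> {ffun 'I_extra_tapes.+1 -> symbol aux} ->
          state * ('I_extra_tapes.+1 -> symbol aux * direction)
}.

(* The squares to the left of the head are listed from the nearest one outwards,
   and so are those to its right; all squares not listed are blank. *)
Record tape (A : Type) := Tape {
  lefts : seq (option A);
  scanned : option A;
  rights : seq (option A)
}.

Section Tapes.
Variable A : Type.

Definition input_tape (w : seq A) : tape A :=
  if w is a :: w' then Tape [::] (Some a) (map Some w')
  else Tape [::] None [::].

Definition write_move (sd : option A * direction) (t : tape A) : tape A :=
  let: (s, d) := sd in
  match d with
  | MoveLeft => Tape (behead (lefts t)) (head None (lefts t)) (s :: rights t)
  | Stay => Tape (lefts t) s (rights t)
  | MoveRight => Tape (s :: lefts t) (head None (rights t)) (behead (rights t))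
  end.

End Tapes.

Section Runs.
Variable M : machine.

Record config := Config {
  cstate : state M;
  ctapes : 'I_(extra_tapes M).+1 -> tape (bool + aux M)
}.

Definition init_config (w : seq bool) : config :=
  Config (start M)
    (fun i => input_tape (if i == ord0 then map inl w else [::])).

Definition step (c : config) : config :=
  if verdict (cstate c) is Some _ then c
  else let: (q, act) := delta (cstate c) [ffun i => scanned (ctapes c i)] in
       Config q (fun i => write_move (act i) (ctapes c i)).

Definition answers_within (w : seq bool) (T : nat) (b : bool) : Prop :=
  exists2 t, t <= T & verdict (cstate (iter t step (init_config w))) = Some b.

End Runs.

Record decision_problem := DecisionProblem {
  instance : Type;
  encode : instance -> seq bool;
  yes : instance -> Prop
}.

(* Nothing is required of the machine on words that do not encode an instance
   in the class [D]. *)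
Definition poly_time_solvable_on (P : decision_problem) (D : instance P -> Prop)
    : Prop :=
  exists (M : machine) (p : {poly nat}), forall x : instance P, D x ->
    exists b : bool,
      answers_within M (encode x) p.[size (encode x)]%R b /\ (b <-> yes x).

Record op_instance := OpInstance {
  op_order : nat;
  op_graph : sgraph 'I_op_order;
  op_size : nat;
  op_size_bounds : 0 < op_size <= op_order
}.

(* The order and the size bound in unary, each closed by a 0, followed by the
   adjacency matrix in row-major order. As k <= n, writing k in unary instead
   of binary does not affect membership in polynomial time. *)
Definition op_encode (x : op_instance) : seq bool :=
  nseq (op_order x) true ++ false :: nseq (op_size x) true ++ false ::
  [seq op_graph x i j | i <- enum 'I_(op_order x), j <- enum 'I_(op_order x)].

Definition op_yes (x : op_instance) : Prop :=
  exists S : {set 'I_(op_order x)},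
    open_packing (op_graph x) S /\ op_size x <= #|S|.

Definition open_packing_problem : decision_problem :=
  DecisionProblem op_encode op_yes.

(* Main.v *)
Require Import Defs.
From HB Require Import structures.
From Stdlib Require Import FunctionalExtensionality.
From mathcomp Require Import all_boot all_order all_algebra zify.

(** Process the vertices by increasing degree, and choose a vertex whenever its
    neighbourhood is disjoint from those of all vertices chosen so far. On claw-free
    split graphs this greedy procedure finds a maximum open packing. Let K be a clique
    such that the rest I is independent and no vertex of I is adjacent to all of K.
    As there is no claw, two distinct vertices of I with a common neighbour cover K
    by their neighbourhoods, and hence no vertex of I has a neighbour in common with
    each of two vertices with disjoint neighbourhoods. So if some open packing has
    three non-isolated vertices, then the vertices of I have pairwise
    disjoint neighbourhoods and degrees less than |K| - 1, so that they are all chosen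
    before any vertex of K is considered. If the maximum is two, the choice of a
    vertex of minimal degree always leaves room for a second one.

    The greedy procedure is run by a Turing machine with four tapes that reads the
    adjacency matrix n + 1 times, once for every degree d = 0, ..., n. *)

Set Implicit Arguments.
Unset Strict Implicit.
Unset Printing Implicit Defensive.

(** * Greedy open packings *)

Section GreedyPacking.
Variables (T : finType) (G : sgraph T).
Implicit Types (S K : {set T}) (a b v w x y z : T).

Definition conflict x y := [exists z, G x z && G y z].
Definition nonisolated x := [exists z, G x z].

(** All that is used of the greedy procedure, whatever its order among vertices of equal degree. An
    isolated vertex conflicts with nothing, so the second clause forces it into [S]. *)
Definition greedy_packing S : Prop :=
  {in S &, forall x y, x != y -> ~~ conflict x y} /\
  forall v, v \notin S ->
    exists2 x, x \in S & conflict x v && (#|nbhd G x| <= #|nbhd G v|).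

Lemma conflictP x y : reflect (exists z, G x z /\ G y z) (conflict x y).
Proof.
by apply: (iffP existsP) => -[z]; [case/andP | case]; exists z => //; apply/andP.
Qed.

Lemma conflict_sym : symmetric conflict.
Proof. by move=> x y; apply: eq_existsb => z; rewrite andbC. Qed.

Lemma conflict_refl x : nonisolated x -> conflict x x.
Proof. by case/existsP=> z xz; apply/conflictP; exists z. Qed.

Lemma conflict_nonisolated x y : conflict x y -> nonisolated x && nonisolated y.
Proof. by case/conflictP=> z [xz yz]; apply/andP; split; apply/existsP; exists z. Qed.

Lemma conflictE x y : (nbhd G x :&: nbhd G y != set0) = conflict x y.
Proof.
apply/set0Pn/conflictP => -[z]; first by rewrite !inE => /andP; exists z.
by case=> xz yz; exists z; rewrite !inE xz yz.
Qed.

Lemma open_packingP S :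
  open_packing G S <-> {in S &, forall x y, x != y -> ~~ conflict x y}.
Proof.
split=> h x y xS yS xy; first by rewrite -conflictE negbK; apply/eqP/h.
by apply/eqP; rewrite -[_ == _]negbK conflictE h.
Qed.

(** If a vertex [a] outside the given clique is adjacent to all of it, moving [a] into the clique
    suffices: no other vertex outside is adjacent to [a]. *)
Lemma split_maximal_clique : split_graph G ->
  exists K, [/\ clique G K, independent G (~: K) &
    forall a, a \notin K -> exists2 v, v \in K & ~~ G a v].
Proof.
case=> C [hC hI].
case: (boolP [exists a, (a \notin C) && [forall v in C, G a v]]) => [|none]; last first.
  exists C; split=> // a aC; move: none; rewrite negb_exists => /forallP/(_ a).
  by rewrite aC negb_forall_in => /exists_inP.
case/existsP=> a /andP[aC /forall_inP aadj]; exists (a |: C); split.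
- move=> x y; rewrite !inE => /predU1P[->|xC] /predU1P[->|yC] xy.
  + by rewrite eqxx in xy.
  + exact: aadj.
  + by rewrite adj_sym aadj.
  + exact: hC.
- by move=> x y; rewrite !inE !negb_or => /andP[_ xC] /andP[_ yC]; apply: hI; rewrite inE.
- move=> b; rewrite inE negb_or => /andP[ba bC]; exists a; first by rewrite setU11.
  by apply: hI; rewrite inE.
Qed.

(** * Neighbourhoods in claw-free split graphs *)

Hypothesis clawG : claw_free G.

Lemma claw_freeP v a b c : G v a -> G v b -> G v c ->
  a != b -> a != c -> b != c -> [|| G a b, G a c | G b c].
Proof.
move=> va vb vc ab ac bc; apply/negP=> /negP; rewrite !negb_or.
case/and3P=> nab nac nbc; apply: clawG.
have irr := adj_irr G; have s := adj_sym G.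
have [av bv cv] : [/\ v != a, v != b & v != c].
  by split; apply/eqP => e; subst; rewrite irr in va vb vc.
pose f (u : 'I_1 + 'I_3) := match u with inl _ => v | inr i => nth v [:: a; b; c] i end.
exists f; split.
  move=> [i|[[|[|[|i]]] hi]] [j|[[|[|[|j]]] hj]] //= e; try congr inr; try exact: val_inj;
    try by move: ab ac bc av bv cv; rewrite ?e ?eqxx // -?e ?eqxx.
  by congr inl; rewrite !ord1.
by move=> [i|[[|[|[|i]]] hi]] [j|[[|[|[|j]]] hj]] //=; rewrite ?irr // 1?s //;
  apply/negbTE => //; rewrite s.
Qed.

Variable K : {set T}.
Hypotheses (cliqueK : clique G K) (indepK : independent G (~: K)).
Hypothesis maxK : forall a, a \notin K -> exists2 v, v \in K & ~~ G a v.

Lemma nbr_in_clique x v : x \notin K -> G x v -> v \in K.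
Proof.
move=> xK xv; apply/negPn/negP => vK.
by have := indepK (x := x) (y := v); rewrite !inE xK vK xv => /(_ isT isT).
Qed.

(* Otherwise a common neighbour of [a] and [b] is the centre of a claw with
   leaves [a], [b], [w]. *)
Lemma conflict_cover a b w : a \notin K -> b \notin K -> a != b -> conflict a b ->
  w \in K -> G a w || G b w.
Proof.
move=> aK bK ab /conflictP[v [av bv]] wK.
have vK := nbr_in_clique aK av.
have [->|wv] := eqVneq w v; first by rewrite av.
have aw : a != w by apply: contraNneq aK => ->.
have bw : b != w by apply: contraNneq bK => ->.
have vw : G v w by apply: cliqueK; rewrite // eq_sym.
rewrite adj_sym in av; rewrite adj_sym in bv.
case/or3P: (claw_freeP av bv vw ab aw bw) => [|->|->] //; last by rewrite orbT.
by move/(nbr_in_clique aK); rewrite (negbTE bK).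
Qed.

(** By [conflict_cover], a vertex [t] of [K] that is not adjacent to [a] must be adjacent to both
    [x] and [y]. *)
Lemma conflict_two a x y : a \notin K -> x \notin K -> y \notin K ->
  conflict a x -> conflict a y -> conflict x y.
Proof.
move=> aK xK yK ax ay; apply: contraT => nxy.
have anx : a != x by apply: contraNneq nxy => <-.
have any : a != y by apply: contraNneq nxy => <-; rewrite conflict_sym.
have [t tK /negP[]] := maxK aK.
case/orP: (conflict_cover aK xK anx ax tK) => // xt.
case/orP: (conflict_cover aK yK any ay tK) => // yt.
by case/negP: nxy; apply/conflictP; exists t.
Qed.

(** If [a] and [b] conflict, their neighbourhoods cover [K], so each of [x], [y], [z] conflicts with
    [a] or [b]. By pigeonhole two of them conflict with the same one, hence with each other by
    [conflict_two]. *)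
Lemma three_no_conflict x y z a b : x \notin K -> y \notin K -> z \notin K ->
  nonisolated x -> nonisolated y -> nonisolated z ->
  ~~ conflict x y -> ~~ conflict x z -> ~~ conflict y z ->
  a \notin K -> b \notin K -> a != b -> ~~ conflict a b.
Proof.
move=> xK yK zK nx ny nz xy xz yz aK bK ab; apply/negP => cab.
have cov t : t \notin K -> nonisolated t -> conflict a t || conflict b t.
  move=> tK /existsP[w tw].
  case/orP: (conflict_cover aK bK ab cab (nbr_in_clique tK tw)) => h; apply/orP;
    [left | right]; by apply/conflictP; exists w.
case/orP: (cov x xK nx) => hx; case/orP: (cov y yK ny) => hy;
  case/orP: (cov z zK nz) => hz.
all: try (by rewrite (conflict_two _ _ _ hx hy) in xy).
all: try (by rewrite (conflict_two _ _ _ hx hz) in xz).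
all: by rewrite (conflict_two _ _ _ hy hz) in yz.
Qed.

(** If [t] is outside [K], its neighbours lie in [K], and any of them other than [x] would also be
    adjacent to [x]. *)
Lemma compatible_adj x t : x \in K -> t != x -> nonisolated t -> ~~ conflict x t -> G t x.
Proof.
move=> xK tx /existsP[w tw] nxt.
have [tK|tK] := boolP (t \in K); first exact: cliqueK.
have [<-//|wx] := eqVneq w x.
case/negP: nxt; apply/conflictP; exists w; split=> //.
by apply: cliqueK => //; [exact: nbr_in_clique tw | rewrite eq_sym].
Qed.

(** If [x] were in [K], it would itself be a common neighbour of [y] and [z]. *)
Lemma three_notin_clique x y z : x != y -> x != z ->
  nonisolated y -> nonisolated z ->
  ~~ conflict x y -> ~~ conflict x z -> ~~ conflict y z -> x \notin K.
Proof.
move=> xy xz ny nz cxy cxz; apply: contra => xK; apply/conflictP; exists x.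
by split; apply: compatible_adj => //; rewrite eq_sym.
Qed.

Lemma clique_subset_nbhd u : u \in K -> K :\ u \subset nbhd G u.
Proof.
move=> uK; apply/subsetP => w; rewrite !inE => /andP[wu wK].
by apply: cliqueK => //; rewrite eq_sym.
Qed.

(** If [x] is rejected, it conflicts with some [u] in [S] of at most the same degree. By
    [three_no_conflict], [u] lies in [K] and so has degree at least [#|K| - 1]; but [x] misses a
    neighbour of [y] and another one of [z], so its degree is at most [#|K| - 2]. *)
Lemma three_in_greedy S x y z : greedy_packing S ->
  x != y -> x != z -> y != z -> nonisolated x -> nonisolated y -> nonisolated z ->
  ~~ conflict x y -> ~~ conflict x z -> ~~ conflict y z -> x \in S.
Proof.
move=> [_ gS] xy xz yz nx ny nz cxy cxz cyz.
have xK : x \notin K by apply: (@three_notin_clique x y z).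
have yK : y \notin K.
  by apply: (@three_notin_clique y x z) => //; rewrite 1?eq_sym // conflict_sym.
have zK : z \notin K.
  apply: (@three_notin_clique z x y) => //; rewrite 1?eq_sym // 1?conflict_sym //.
apply/negPn/negP => xS; have [u uS /andP[cux]] := gS x xS; apply/negP; rewrite -ltnNge.
have ux : u != x by apply: contraNneq xS => <-.
have [uK|uK] := boolP (u \in K); last first.
  by case/negP: (three_no_conflict xK yK zK nx ny nz cxy cxz cyz uK xK ux).
have /existsP[y' yy'] := ny; have /existsP[z' zz'] := nz.
have y'K := nbr_in_clique yK yy'; have z'K := nbr_in_clique zK zz'.
have yz' : z' != y'.
  by apply: contraNneq cyz => e; apply/conflictP; exists y'; split=> //; rewrite -e.
have sub : nbhd G x \subset K :\ y' :\ z'.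
  apply/subsetP => w; rewrite !inE => xw; rewrite (nbr_in_clique xK xw) andbT.
  apply/andP; split.
    by apply: contraNneq cxz => e; apply/conflictP; exists w; split=> //; rewrite e.
  by apply: contraNneq cxy => e; apply/conflictP; exists w; split=> //; rewrite e.
apply: leq_ltn_trans (subset_leq_card sub) 
  (leq_trans _ (subset_leq_card (clique_subset_nbhd uK))).
have eu : #|K| = #|K :\ u|.+1 by rewrite (cardsD1 u K) uK.
have ey : #|K| = #|K :\ y'|.+1 by rewrite (cardsD1 y' K) y'K.
have ez : #|K :\ y'| = #|K :\ y' :\ z'|.+1.
  by rewrite (cardsD1 z' (K :\ y')) !inE yz' z'K.
by rewrite -[#|K :\ u|]succnK -eu ey ez.
Qed.

Lemma card_nbhd_independent v : v \notin K -> #|nbhd G v| < #|K|.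
Proof.
move=> vK; have [t tK vt] := maxK vK.
have sub : nbhd G v \subset K :\ t.
  apply/subsetP => w; rewrite !inE => vw; rewrite (nbr_in_clique vK vw) andbT.
  by apply: contraNneq vt => <-.
by rewrite (cardsD1 t K) tK ltnS subset_leq_card.
Qed.

(* The next two lemmas rule out that a greedy packing with a single non-isolated
   vertex [a] misses a pair of compatible vertices [p], [q]. *)
Lemma min_degree_independent a p q : a \notin K ->
  (forall v, nonisolated v -> conflict a v && (#|nbhd G a| <= #|nbhd G v|)) ->
  nonisolated a -> p != q -> nonisolated p -> nonisolated q -> conflict p q.
Proof.
move=> aK min /existsP[w aw] pq np nq.
have nw : nonisolated w by apply/existsP; exists a; rewrite adj_sym.
(* The neighbour [w] of [a] also conflicts with [a], so [a], [w] and [z] form a triangle; by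
   minimality every non-isolated vertex has degree at least two. *)
have [z [az wz]] : exists z, G a z /\ G w z by case/andP: (min w nw) => /conflictP.
have zw : z != w by apply/eqP => e; rewrite e adj_irr in wz.
have [t tK at_] := maxK aK.
have wK := nbr_in_clique aK aw; have zK := nbr_in_clique aK az.
have tw : t != w by apply: contraNneq at_ => ->.
have tz : t != z by apply: contraNneq at_ => ->.
have deg2 v : nonisolated v -> 1 < #|nbhd G v|.
  case/min/andP=> _; apply: leq_trans; apply/card_gt1P; exists w, z.
  by rewrite !inE eq_sym.
(* Of two neighbours of [y], both in [K], one differs from [x] and is therefore adjacent to it. *)
have mixed x y : x \in K -> y \notin K -> nonisolated y -> conflict x y.
  move=> xK yK /deg2/card_gt1P[c [d [+ + cd]]]; rewrite !inE => yc yd.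
  have [s ys sx] : exists2 s, G y s & x != s.
    have [e|] := eqVneq x c; last by exists c.
    by exists d; rewrite // e.
  apply/conflictP; exists s; split=> //.
  by apply: cliqueK => //; apply: nbr_in_clique ys.
have [pK|pK] := boolP (p \in K); have [qK|qK] := boolP (q \in K).
(* [w], [z] and [t] are three vertices of [K], so one of them differs from both [p] and [q]. *)
- have [s sK /andP[ps qs]] : exists2 s, s \in K & (p != s) && (q != s).
    have [pw|pw] := eqVneq p w; last have [qw|qw] := eqVneq q w.
    + have [qz|qz] := eqVneq q z; last by exists z; rewrite // qz pw eq_sym zw.
      by exists t; rewrite // pw qz eq_sym tw eq_sym tz.
    + have [pz|pz] := eqVneq p z; last by exists z; rewrite // pz qw eq_sym zw.
      by exists t; rewrite // pz qw eq_sym tz eq_sym tw.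
    + by exists w; rewrite // pw qw.
  by apply/conflictP; exists s; split; apply: cliqueK.
- exact: mixed.
- by rewrite conflict_sym mixed.
- have /andP[ap _] := min p np; have /andP[aq _] := min q nq.
  exact: conflict_two ap aq.
Qed.

Lemma min_degree_clique a p q : a \in K ->
  (forall v, nonisolated v -> conflict a v && (#|nbhd G a| <= #|nbhd G v|)) ->
  p != a -> q != a -> nonisolated p -> nonisolated q -> conflict p q.
Proof.
move=> aK min pa qa np nq.
have Ka : #|K| = #|K :\ a|.+1 by rewrite (cardsD1 a K) aK.
(* The degree of [a] is at most that of [v], hence less than [#|K|], so [a] has no neighbour outside
   [K]. In particular [v] is not adjacent to [a], and comparing cardinalities determines its
   neighbourhood. *)
have nbhd_ind v : v \notin K -> nonisolated v -> nbhd G v = K :\ a /\ nbhd G a = K :\ a.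
  move=> vK nv; have /andP[_ av] := min v nv.
  have va : #|nbhd G v| <= #|K :\ a| by rewrite -ltnS -Ka card_nbhd_independent.
  have ea : nbhd G a = K :\ a.
    apply/esym/eqP; rewrite eqEcard clique_subset_nbhd //=; exact: leq_trans va.
  split=> //; apply/eqP; rewrite eqEcard -ea av andbT.
  apply/subsetP => w; rewrite ea !inE => vw; rewrite (nbr_in_clique vK vw) andbT.
  apply/eqP => wa; move/setP/(_ v): ea; rewrite !inE (negbTE vK) andbF => /negP[].
  by rewrite adj_sym -wa.
have mixed x y : x \in K -> nonisolated x -> y \notin K -> nonisolated y -> conflict x y.
  move=> xK nx yK ny; have [ey ea] := nbhd_ind y yK ny.
  have /andP[/conflictP[w [aw xw]] _] := min x nx.
  apply/conflictP; exists w; split=> //.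
  by move/setP/(_ w): ey; rewrite -ea !inE aw.
have [pK|pK] := boolP (p \in K); have [qK|qK] := boolP (q \in K).
- by apply/conflictP; exists a; split; apply: cliqueK.
- exact: mixed.
- by rewrite conflict_sym mixed.
- have [ep _] := nbhd_ind p pK np; have [eq _] := nbhd_ind q qK nq.
  case/existsP: np => w pw; apply/conflictP; exists w; split=> //.
  by move/setP/(_ w): eq; rewrite -ep !inE pw.
Qed.

(** Isolated vertices, all of which are in [S], are counted separately. If [S'] has at least three
    non-isolated vertices, they all belong to [S]. Otherwise a larger [S'] would have two of them
    and [S] a single one, [a], of minimal degree and in conflict with every non-isolated vertex; the
    two preceding lemmas exclude this. *)
Lemma greedy_packing_maximum_in S S' : greedy_packing S ->
  {in S' &, forall x y, x != y -> ~~ conflict x y} -> #|S'| <= #|S|.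
Proof.
move=> gS hS'; have [hS dom] := gS.
pose N := [set x | nonisolated x].
have isoS : S' :\: N \subset S :\: N.
  apply/subsetP => x; rewrite !inE => /andP[nx _]; rewrite nx /=.
  apply: contraT => /dom[u _ /andP[/conflict_nonisolated/andP[_]]].
  by rewrite (negbTE nx).
rewrite -(cardsID N S') -(cardsID N S) leq_add ?(subset_leq_card isoS) //.
have [big|small] := ltnP 2 #|S' :&: N|.
  apply/subset_leq_card/subsetP => x xS'N.
  have /card_gt1P[y [z [+ + yz]]] : 1 < #|(S' :&: N) :\ x|.
    by rewrite -ltnS; move: big; rewrite (cardsD1 x) xS'N.
  move: xS'N; rewrite !inE => /andP[xS' nx] /andP[yx /andP[yS' ny]] /andP[zx /andP[zS' nz]].
  rewrite nx andbT; rewrite eq_sym in yx; rewrite eq_sym in zx.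
  by apply: (@three_in_greedy S x y z) => //; apply: hS'.
have [//|S0] := leqP #|S' :&: N| #|S :&: N|.
have [p pS'N] : exists p, p \in S' :&: N by apply/card_gt0P; apply: leq_trans S0.
have dom' v : nonisolated v -> exists2 u, u \in S :&: N &
    conflict u v && (#|nbhd G u| <= #|nbhd G v|).
  move=> nv; have [vS|/dom[u uS uv]] := boolP (v \in S).
    by exists v; rewrite ?inE ?vS ?leqnn ?andbT //= conflict_refl.
  exists u => //; rewrite !inE uS /=.
  by case/andP: uv => /conflict_nonisolated/andP[].
have [a aSN] : exists a, a \in S :&: N.
  by move: pS'N; rewrite inE [p \in N]inE => /andP[_ /dom'[a aSN _]]; exists a.
have S1 : #|S :&: N| = 1.
  apply/eqP; rewrite eqn_leq; apply/andP; split; last by apply/card_gt0P; exists a.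
  by rewrite -ltnS; apply: leq_trans small.
have /card_gt1P[p' [q' [+ + pq]]] : 1 < #|S' :&: N| by rewrite -S1.
rewrite !inE => /andP[pS np] /andP[qS nq].
have aE u : u \in S :&: N -> u = a.
  by case/eqP/cards1P: S1 aSN => b ->; rewrite !inE => /eqP -> /eqP.
have min v : nonisolated v -> conflict a v && (#|nbhd G a| <= #|nbhd G v|).
  by case/dom' => u /aE ->.
have na : nonisolated a by move: aSN; rewrite !inE => /andP[].
have npq := hS' p' q' pS qS pq.
have pa : p' != a by apply: contraNneq npq => ->; case/andP: (min q' nq).
have qa : q' != a.
  by apply: contraNneq npq => ->; rewrite conflict_sym; case/andP: (min p' np).
case/negP: npq; have [aK|aK] := boolP (a \in K).
  exact: min_degree_clique min pa qa np nq.
exact: min_degree_independent min na pq np nq.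
Qed.

End GreedyPacking.

Lemma greedy_packing_maximum (T : finType) (G : sgraph T) (S S' : {set T}) :
  split_graph G -> claw_free G -> greedy_packing G S -> open_packing G S' -> #|S'| <= #|S|.
Proof.
move=> /split_maximal_clique[K [cliqueK indepK maxK]] clawG gS /open_packingP.
exact: (greedy_packing_maximum_in clawG cliqueK indepK maxK gS).
Qed.

(** * The Turing machine *)

Import Order.TTheory GRing.Theory Num.Theory.

Local Open Scope ring_scope.

(** * Tapes as functions on the integers *)

Section FunctionTapes.
Variable A : Type.

(** Absolute positions replace the lists on both sides of the head, so that a stretch of computation
    is described by equations between contents and positions. *)
Definition ftape : Type := ((int -> option A) * int)%type.

Definition shift (d : direction) : int :=
  match d with MoveLeft => -1 | Stay => 0 | MoveRight => 1 end.

Definition upd (f : int -> option A) (p : int) (s : option A) : int -> option A :=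
  fun z => if z == p then s else f z.

Definition fwrite (sd : option A * direction) (t : ftape) : ftape :=
  (upd t.1 t.2 sd.1, t.2 + shift sd.2).

(* The absolute position of a tape is arbitrary, so the same tape is represented
   by all translates of a pair (contents, head position). *)
Definition represents (a : ftape) (t : tape A) : Prop :=
  scanned t = a.1 a.2 /\
  forall i : nat, nth None (lefts t) i = a.1 (a.2 - i.+1%:Z) /\
                  nth None (rights t) i = a.1 (a.2 + i.+1%:Z).

Lemma upd_same f p s : f p = s -> upd f p s = f.
Proof.
by move=> fp; apply: functional_extensionality => z; rewrite /upd; case: eqP => // ->.
Qed.

Lemma represents_write a t sd :
  represents a t -> represents (fwrite sd a) (write_move sd t).
Proof.
case: a t sd => f p [l x r] [s d] [/= sx h].
have hl i : nth None l i = f (p - i.+1%:Z) by case: (h i).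
have hr i : nth None r i = f (p + i.+1%:Z) by case: (h i).
rewrite /fwrite /represents /upd /=; case: d => /=.
- split; first by rewrite -nth0 hl; case: eqP => [|_]; [lia|congr f; lia].
  move=> i; rewrite nth_behead hl; split.
    by case: eqP => [|_]; [lia|congr f; lia].
  case: i => [|i] /=; first by case: eqP => //; lia.
  by rewrite hr; case: eqP => [|_]; [lia|congr f; lia].
- split; first by rewrite addr0 eqxx.
  by move=> i; rewrite hl hr; split; case: eqP => [|_]; try lia; congr f; lia.
- split; first by rewrite -nth0 hr; case: eqP => [|_]; [lia|congr f; lia].
  move=> i; rewrite nth_behead hr; split; last first.
    by case: eqP => [|_]; [lia|congr f; lia].
  case: i => [|i] /=; first by case: eqP => //; lia.
  by rewrite hl; case: eqP => [|_]; [lia|congr f; lia].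
Qed.

Definition word_fun (w : seq A) (z : int) : option A :=
  if 0 <= z then nth None (map Some w) `|z|%N else None.

Lemma represents_input w p :
  represents (fun z => word_fun w (z - p), p) (input_tape w).
Proof.
rewrite /represents /word_fun /=; split=> [|i].
  by rewrite subrr /=; case: w.
split.
  rewrite (_ : 0 <= _ = false); last by lia.
  by case: w => [|a w] /=; rewrite nth_nil.
rewrite (_ : 0 <= _ = true); last by lia.
rewrite (_ : `|_|%N = i.+1); last by lia.
by case: w => [|a w] //=; rewrite nth_nil.
Qed.

End FunctionTapes.

(** * The machine and its simulation on function tapes *)

Inductive phase :=
  ReadN | ReadK | Fwd of bool | Bwd of bool | Rew | Chk | Halt of bool.

(** An injection into sums of booleans, from which [phase] gets its finite type structure. *)
Definition phase_code (q : phase) : bool + bool + (bool + (bool + bool)) :=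
  match q with
  | ReadN => inl (inl true) | ReadK => inl (inl false)
  | Rew => inl (inr true) | Chk => inl (inr false)
  | Fwd b => inr (inl b) | Bwd b => inr (inr (inl b))
  | Halt b => inr (inr (inr b))
  end.

Definition phase_decode (x : bool + bool + (bool + (bool + bool))) : phase :=
  match x with
  | inl (inl true) => ReadN | inl (inl false) => ReadK
  | inl (inr true) => Rew | inl (inr false) => Chk
  | inr (inl b) => Fwd b | inr (inr (inl b)) => Bwd b
  | inr (inr (inr b)) => Halt b
  end.

Lemma phase_codeK : cancel phase_code phase_decode.
Proof. by case. Qed.

HB.instance Definition _ := Finite.copy phase (can_type phase_codeK).

Local Notation sym := (symbol (bool * bool)%type).

Definition bit (b : bool) : sym := Some (inl b).
Definition cell (u r : bool) : sym := Some (inr (u, r)).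
Definition keep (s : sym) : sym * direction := (s, Stay).

(* Tape 0 is the input. Tape 1 has one cell (u, r) per vertex z: u tells whether z
   is adjacent to a chosen vertex, r is the bit z of the row being read. Tape 2 is
   0 1^n; at the start of each row its head is at position d, and it moves left at
   every 1 of the row, so that it ends on the 0 iff the degree is d. Tape 3 is 1^k,
   on which the head moves right each time a vertex is chosen; it scans a blank iff
   at least k vertices have been chosen.

   [ReadN] and [ReadK] fill the tapes, the latter also replacing by a blank the 0
   preceding the matrix. [Fwd f] reads a row, [f] telling that it is so far disjoint
   from the covered vertices; [Bwd g] goes back over the row, adding it to the
   covered vertices if [g]; [Rew] rewinds the matrix, after which d is increased. *)
Definition trans (q : phase) (s0 s1 s2 s3 : sym) : phase * seq (sym * direction) :=
  let b := s0 == bit true in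
  match q with
  | ReadN =>
      if b then (ReadN, [:: (s0, MoveRight); (cell false false, MoveLeft);
                            (bit true, MoveLeft); keep s3])
      else (ReadK, [:: (s0, MoveRight); (s1, MoveRight); keep (bit false); keep s3])
  | ReadK =>
      if b then (ReadK, [:: (s0, MoveRight); keep s1; keep s2; (bit true, MoveLeft)])
      else (Fwd true, [:: (None, MoveRight); keep s1; keep s2; (s3, MoveRight)])
  | Fwd f =>
      if s1 is Some (inr (u, _)) then
        (Fwd (f && ~~ (u && b)),
         [:: (s0, MoveRight); (cell u b, MoveRight);
             (s2, if b then MoveLeft else Stay); keep s3])
      else
        let g := f && (s2 == bit false) in
        (Bwd g, [:: keep s0; (s1, MoveLeft); keep s2;
                    (s3, if g then MoveRight else Stay)])
  | Bwd g =>
      if s1 is Some (inr (u, r)) then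
        (Bwd g, [:: keep s0; (cell (u || g && r) r, MoveLeft);
                    (s2, if r then MoveRight else Stay); keep s3])
      else if s0 is None then
        (Rew, [:: (s0, MoveLeft); (s1, MoveRight); keep s2; keep s3])
      else (Fwd true, [:: keep s0; (s1, MoveRight); keep s2; keep s3])
  | Rew =>
      if s0 is None then
        (Chk, [:: (s0, MoveRight); keep s1; (s2, MoveRight); keep s3])
      else (Rew, [:: (s0, MoveLeft); keep s1; keep s2; keep s3])
  | Chk =>
      (if s2 is None then Halt (s3 == None) else Fwd true,
       [:: keep s0; keep s1; keep s2; keep s3])
  | Halt b => (Halt b, [:: keep s0; keep s1; keep s2; keep s3])
  end.

Definition ord4 (i : nat) : 'I_4 := inord i.

Definition op_machine : machine :=
  @Machine 3 (bool * bool)%type phase ReadN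
    (fun q => if q is Halt b then Some b else None)
    (fun q s =>
       let: (q', acts) := trans q (s (ord4 0)) (s (ord4 1)) (s (ord4 2)) (s (ord4 3)) in
       (q', fun i : 'I_4 => nth (keep None) acts i)).

Local Notation tp := (ftape (bool + bool * bool)).

Record fconfig := FConfig { fphase : phase; t0 : tp; t1 : tp; t2 : tp; t3 : tp }.

Definition ftapes (c : fconfig) : seq tp := [:: t0 c; t1 c; t2 c; t3 c].

Definition blank_tape : tp := (fun=> None, 0).

Definition fstep (c : fconfig) : fconfig :=
  let: FConfig q t0 t1 t2 t3 := c in
  let: (q', acts) := trans q (t0.1 t0.2) (t1.1 t1.2) (t2.1 t2.2) (t3.1 t3.2) in
  let a i := nth (keep None) acts i in
  FConfig q' (fwrite (a 0%N) t0) (fwrite (a 1%N) t1) (fwrite (a 2%N) t2) (fwrite (a 3%N) t3).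

Definition crep (a : fconfig) (c : config op_machine) : Prop :=
  cstate c = fphase a /\
  forall i : 'I_4, represents (nth blank_tape (ftapes a) i) (ctapes c i).

Lemma fwrite_keep (t : tp) : fwrite (keep (t.1 t.2)) t = t.
Proof. by case: t => f p; rewrite /fwrite /= addr0 upd_same. Qed.

(** The pair [qa] is kept abstract, so that the simulation of a step needs no case analysis on the
    scanned symbols. *)
Lemma crep_write (qa : phase * seq (sym * direction)) u0 u1 u2 u3
    (ts : 'I_4 -> tape (bool + bool * bool)) :
  (forall i : 'I_4, represents (nth blank_tape [:: u0; u1; u2; u3] i) (ts i)) ->
  crep (let: (q, acts) := qa in
        FConfig q (fwrite (nth (keep None) acts 0%N) u0) (fwrite (nth (keep None) acts 1%N) u1)
          (fwrite (nth (keep None) acts 2%N) u2) (fwrite (nth (keep None) acts 3%N) u3))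
       (let: (q, act) := let: (q, acts) := qa in
                         (q, fun i : 'I_4 => nth (keep None) acts i) in
        @Config op_machine q (fun i => write_move (act i) (ts i))).
Proof.
case: qa => q acts h /=; split=> //= i.
have := represents_write (nth (keep None) acts i) (h i).
by case: i => [] [|[|[|[|i]]]].
Qed.

Lemma crep_step a c : crep a c -> crep (fstep a) (step c).
Proof.
case: a c => q u0 u1 u2 u3 [q' ts] /= [/= -> h].
have e (i : 'I_4) : scanned (ts i) =
   (nth blank_tape [:: u0; u1; u2; u3] i).1 (nth blank_tape [:: u0; u1; u2; u3] i).2.
  by case: (h i).
have := crep_write (trans q (u0.1 u0.2) (u1.1 u1.2) (u2.1 u2.2) (u3.1 u3.2)) h.
(* In a halting phase [step] is the identity, and so is [fstep], which writes every scanned symbol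
   back in place. *)
rewrite /step /=; case: q h => [||f|g|||b] h; last by rewrite /= !fwrite_keep.
all: by rewrite /= !ffunE !e !inordK.
Qed.

(** * The main loop over the matrix *)

Section Main.
Variables (n k : nat) (row : nat -> nat -> bool) (inf Df Cf : int -> sym).
Hypothesis n_gt0 : (0 < n)%N.
Hypothesis inf_before : inf (-1) = None.
Hypothesis inf_row : forall y z, (y < n)%N -> (z < n)%N ->
  inf (y * n + z)%N = bit (row y z).
Hypothesis inf_after : inf (n * n)%N = None.
Hypothesis Df0 : Df 0 = bit false.
Hypothesis Df_inside : forall p : nat, (0 < p <= n)%N -> Df p = bit true.
Hypothesis Df_outside : forall p : int, (p < 0) || (n%:Z < p) -> Df p = None.
Hypothesis Cf_None : forall p : nat, (Cf p == None) = (k <= p)%N.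

Definition Ufun (u r : nat -> bool) (z : int) : sym :=
  if (0 <= z) && (z < n%:Z) then cell (u `|z|%N) (r `|z|%N) else None.

Lemma eq_Ufun u r u' r' :
  (forall z, (z < n)%N -> u z = u' z) -> (forall z, (z < n)%N -> r z = r' z) ->
  Ufun u r = Ufun u' r'.
Proof.
move=> eu er; apply: functional_extensionality => z; rewrite /Ufun.
by case: ifP => // /andP[z0 zn]; rewrite eu ?er //; lia.
Qed.

Lemma Ufun_in u r (j : nat) : (j < n)%N -> Ufun u r j = cell (u j) (r j).
Proof. by move=> jn; rewrite /Ufun ifT //; lia. Qed.

Lemma Ufun_out u r (j : int) : (j < 0) || (n%:Z <= j) -> Ufun u r j = None.
Proof. by move=> jn; rewrite /Ufun ifF //; lia. Qed.

Lemma upd_Ufun u r (j : nat) a b : (j < n)%N ->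
  upd (Ufun u r) j (cell a b) =
  Ufun (fun z => if z == j then a else u z) (fun z => if z == j then b else r z).
Proof.
move=> jn; apply: functional_extensionality => z; rewrite /upd /Ufun.
case: eqP => [->|zj]; first by rewrite ifT ?eqxx //; lia.
case: ifP => // /andP[z0 zn]; rewrite ifF; last by lia.
by rewrite ifF //; lia.
Qed.

Definition cfg q (i : int) u r (j d c : int) : fconfig :=
  FConfig q (inf, i) (Ufun u r, j) (Df, d) (Cf, c).

Lemma fstep_fwd f y u r (j : nat) d c : (y < n)%N -> (j < n)%N ->
  fstep (cfg (Fwd f) (y * n + j)%N u r j d c) =
  cfg (Fwd (f && ~~ (u j && row y j))) (y * n + j.+1)%N u
    (fun z => if z == j then row y j else r z) j.+1 (d - (row y j : nat)%:Z) c.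
Proof.
move=> yn jn; rewrite /= inf_row // Ufun_in // /fwrite /=.
have -> : (bit (row y j) == bit true) = row y j by case: (row y j).
rewrite upd_Ufun // !upd_same ?inf_row //; congr FConfig.
- by congr (_, _); lia.
- by congr (_, _); [apply: eq_Ufun => z //; case: eqP => // ->|lia].
- by congr (_, _); case: (row y j) => /=; lia.
- by congr (_, _); lia.
Qed.

Definition disj (u : nat -> bool) y m := all (fun z => ~~ (u z && row y z)) (iota 0 m).
Definition wt y m : nat := \sum_(0 <= z < m) row y z.

Lemma iter_fwd y u r d c m : (y < n)%N -> (m <= n)%N ->
  iter m fstep (cfg (Fwd true) (y * n)%N u r 0 d c) =
  cfg (Fwd (disj u y m)) (y * n + m)%N u
    (fun z => if (z < m)%N then row y z else r z) m (d - (wt y m)%:Z) c.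
Proof.
move=> yn; elim: m => [|m IH] mn.
  by rewrite /= addn0 /wt big_geq // subr0.
rewrite iterS IH 1?ltnW // fstep_fwd // /cfg; congr FConfig.
- by rewrite /disj -addn1 iotaD all_cat /= andbT.
- congr (_, _); apply: eq_Ufun => z // _.
  by case: eqVneq => [->|zm]; rewrite ltnS ?leqnn // [in RHS]leq_eqVlt (negbTE zm).
- by congr (_, _); rewrite /wt big_nat_recr //=; lia.
Qed.

Lemma fstep_bwd g u r i (j : nat) d c : (j < n)%N ->
  fstep (cfg (Bwd g) i u r j d c) =
  cfg (Bwd g) i (fun z => if z == j then u j || g && r j else u z) r (j%:Z - 1)
    (d + (r j : nat)%:Z) c.
Proof.
move=> jn; rewrite /= Ufun_in // /fwrite /= upd_Ufun // !upd_same //; congr FConfig.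
- by congr (_, _); lia.
- by congr (_, _); apply: eq_Ufun => z //; case: eqP => // ->.
- by congr (_, _); case: (r j) => /=; lia.
- by congr (_, _); lia.
Qed.

(** Each left move made on tape 2 during the forward sweep is undone at the same cell, so after all
    [n] cells the head is back at [d]. *)
Lemma iter_bwd g y u r i d c m : (m <= n)%N ->
  (forall z, (z < n)%N -> r z = row y z) ->
  iter m fstep (cfg (Bwd g) i u r (n%:Z - 1) (d - (wt y n)%:Z) c) =
  cfg (Bwd g) i (fun z => if (n - m <= z)%N then u z || g && row y z else u z) r
    (n%:Z - 1 - m%:Z) (d - (wt y (n - m))%:Z) c.
Proof.
move=> + er; elim: m => [|m IH] mn.
  rewrite /= subn0 /cfg subr0; congr FConfig; congr (_, _).
  by apply: eq_Ufun => z // zn; rewrite ifF //; lia.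
rewrite iterS IH 1?ltnW //.
have -> : n%:Z - 1 - m%:Z = (n - m.+1)%N by lia.
have jn : (n - m.+1 < n)%N by lia.
rewrite fstep_bwd // /cfg; congr FConfig; congr (_, _).
- apply: eq_Ufun => z // zn.
  case: eqP => [->|zj]; first by rewrite ifF ?er //; [rewrite leqnn | lia].
  by congr (if _ then _ else _); lia.
- by lia.
- have -> : (n - m = (n - m.+1).+1)%N by lia.
  by rewrite /wt big_nat_recr //= er //; lia.
Qed.

Definition takes u (d y : nat) := disj u y n && (wt y n == d).

(** The position tested is [d] minus the degree of the row, which can be negative; the blanks to the
    left of 0 keep the test exact. *)
Lemma Df_mark (p : int) : (Df p == bit false) = (p == 0).
Proof.
have [->|p0] := eqVneq p 0; first by rewrite Df0.
case: p p0 => p p0; last by rewrite Df_outside.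
have [pn|pn] := leqP p n; first by rewrite Df_inside //; lia.
by rewrite Df_outside //; lia.
Qed.

(** Each of the two sweeps takes [n] steps and one more to turn round. The row bits left on tape 1
    are existential because the next forward sweep overwrites them. *)
Lemma iter_row y u r (d c : nat) : (y < n)%N ->
  exists r', iter (n.+1 + n.+1) fstep (cfg (Fwd true) (y * n)%N u r 0 d c) =
    cfg (if (y.+1 == n)%N then Rew else Fwd true)
      (if (y.+1 == n)%N then (n * n)%N%:Z - 1 else (y.+1 * n)%N%:Z)
      (fun z => u z || takes u d y && row y z) r' 0 d (c + takes u d y)%N.
Proof.
move=> yn; rewrite iterD [X in iter _ _ X]iterS iter_fwd //.
set r' := fun z => if (z < n)%N then row y z else r z.
have er z : (z < n)%N -> r' z = row y z by rewrite /r' => ->.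
have -> : fstep (cfg (Fwd (disj u y n)) (y * n + n)%N u r' n (d%:Z - (wt y n)%:Z) c) =
   cfg (Bwd (takes u d y)) (y.+1 * n)%N u r' (n%:Z - 1) (d%:Z - (wt y n)%:Z)
     (c + takes u d y)%N.
  rewrite /= Ufun_out ?lexx ?orbT // /fwrite /= !upd_same // ?Ufun_out ?lexx ?orbT //.
  have -> : disj u y n && (Df (d%:Z - (wt y n)%:Z) == bit false) = takes u d y.
    by rewrite Df_mark /takes; congr (_ && _); lia.
  by congr FConfig; congr (_, _); case: (takes u d y) => /=; lia.
rewrite iterS (@iter_bwd _ y) // subnn /wt big_geq // subr0.
exists r'.
(* The square after row [y] holds the first bit of the next row or, after the last row, the blank
   that starts the rewinding. *)
have inE : inf (y.+1 * n)%N = if (y.+1 == n)%N then None else bit (row y.+1 0).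
  case: eqP => [->//|ny]; have := @inf_row y.+1 0; rewrite addn0; apply=> //; lia.
rewrite /= Ufun_out; last by lia.
rewrite inE; case: eqP => [yE|ny]; rewrite /fwrite /= !upd_same //;
  try by rewrite Ufun_out //; lia.
- by congr FConfig; congr (_, _); lia.
- by rewrite inE yE eqxx.
- by congr FConfig; congr (_, _); lia.
- by rewrite inE ifF //; lia.
Qed.
Definition covered (s : seq nat) (z : nat) := has (fun x => row x z) s.

(** The list of chosen vertices determines the covered vertices on tape 1 and, by its size, the head
    position on tape 3. *)
Definition visit (d : nat) (s : seq nat) (y : nat) :=
  if takes (covered s) d y then y :: s else s.

Definition pass (s : seq nat) (d : nat) := foldl (visit d) s (iota 0 n).

Lemma iter_rows s r (d m : nat) : (m <= n)%N ->
  let s' := foldl (visit d) s (iota 0 m) in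
  exists r', iter (m * (n.+1 + n.+1)) fstep
      (cfg (Fwd true) 0 (covered s) r 0 d (size s)) =
    cfg (if (m == n)%N then Rew else Fwd true)
      (if (m == n)%N then (n * n)%N%:Z - 1 else (m * n)%N%:Z)
      (covered s') r' 0 d (size s').
Proof.
elim: m => [|m IH] mn.
  by exists r; rewrite /= ifF ?ifF //; apply/negbTE; rewrite neq_ltn n_gt0.
have [r1 e1] := IH (ltnW mn).
have mn' : (m == n)%N = false by apply/negbTE; rewrite neq_ltn mn.
rewrite mn' in e1.
have [r' e'] := iter_row (covered (foldl (visit d) s (iota 0 m))) r1 d
  (size (foldl (visit d) s (iota 0 m))) mn.
exists r'; rewrite mulSn iterD e1 e' -[in iota _ m.+1]addn1 iotaD foldl_cat /=.
set s1 := foldl _ _ _; rewrite /visit add0n; case: (takes _ _ _); last first.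
  by rewrite /= addn0; congr cfg; apply: functional_extensionality => z; rewrite orbF.
rewrite /= addn1; congr cfg; apply: functional_extensionality => z.
by rewrite /covered /= orbC.
Qed.

Lemma inf_inside (i : nat) : (i < n * n)%N -> inf i <> None.
Proof.
move=> i_lt; rewrite (divn_eq i n) inf_row ?ltn_mod //.
by rewrite ltn_divLR.
Qed.

Lemma iter_rew u r d c m : (m <= n * n)%N ->
  iter m fstep (cfg Rew ((n * n)%N%:Z - 1) u r 0 d c) =
  cfg Rew ((n * n)%N%:Z - 1 - m%:Z) u r 0 d c.
Proof.
elim: m => [|m IH] mn; first by rewrite /= subr0.
rewrite iterS IH 1?ltnW //.
have -> : (n * n)%N%:Z - 1 - m%:Z = (n * n - m.+1)%N by lia.
have /= := @inf_inside (n * n - m.+1).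
case e: (inf _) => [a|] h; last by case: h => //; lia.
rewrite /= /fwrite /= !upd_same //; congr FConfig; congr (_, _); lia.
Qed.

(** Two sweeps per row, then the rewinding, then two steps: the turn at the blank before the matrix
    and the check in [Chk]. *)
Definition round_time := (n * (n.+1 + n.+1) + (n * n).+2)%N.

Lemma iter_round s r (d : nat) : (d <= n)%N ->
  exists r', iter round_time fstep (cfg (Fwd true) 0 (covered s) r 0 d (size s)) =
    cfg (if (d == n)%N then Halt (k <= size (pass s d))%N else Fwd true) 0
      (covered (pass s d)) r' 0 d.+1 (size (pass s d)).
Proof.
move=> dn; have [r' e] := iter_rows s r d (leqnn n); rewrite eqxx -/(pass s d) in e.
exists r'; rewrite /round_time addnC iterD e 2!iterS iter_rew //.
have -> : (n * n)%N%:Z - 1 - (n * n)%N%:Z = -1 by lia.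
rewrite /= inf_before /fwrite /= !upd_same // !addr0 addNr.
have -> : d%:Z + 1 = d.+1 by lia.
(* After the increment, tape 2 scans a blank exactly when the last degree [n] has been treated; tape
   3 then gives the answer. *)
have eD : Df d.+1 = if (d == n)%N then None else bit true.
  case: eqP => [->|ndn]; first by rewrite Df_outside //; lia.
  by rewrite Df_inside //; lia.
by rewrite eD Cf_None; case: eqP eD => _ eD; rewrite /fwrite /= !upd_same ?addr0.
Qed.

Lemma iter_rounds r m : (m <= n.+1)%N ->
  let s := foldl pass [::] (iota 0 m) in
  exists r', iter (m * round_time) fstep (cfg (Fwd true) 0 (fun=> false) r 0 0 0) =
    cfg (if (m == n.+1)%N then Halt (k <= size s)%N else Fwd true) 0
      (covered s) r' 0 m (size s).
Proof.
elim: m => [|m IH] mn; first by exists r.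
have [r1 e1] := IH (ltnW mn).
rewrite (_ : (m == n.+1)%N = false) in e1; last by lia.
have [r' e'] := iter_round (foldl pass [::] (iota 0 m)) r1 mn.
exists r'; rewrite mulSn iterD e1 e' eqSS.
by rewrite -[in iota _ m.+1]addn1 iotaD foldl_cat /= add0n.
Qed.

End Main.

(** * Filling the tapes from the unary prefix *)

Section Setup.
Variables (n k : nat) (bits : seq bool).
Hypothesis size_bits : size bits = (n * n)%N.

Let w := nseq n true ++ false :: nseq k true ++ false :: bits.
Let base : int := (n + k).+2.

(** As [base] is the length of everything before the matrix, the matrix starts at 0. The form
    [z - - base] is that of [represents_input]. *)
Definition input_fun (z : int) : sym := word_fun [seq inl b | b <- w] (z - - base).

Lemma size_word : size w = ((n + k).+2 + n * n)%N.
Proof. by rewrite size_cat /= size_cat /= !size_nseq size_bits; lia. Qed.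

Lemma input_fun_nth (i : nat) z : z = i%:Z - base -> (i < size w)%N ->
  input_fun z = bit (nth false w i).
Proof.
move=> -> iw; rewrite /input_fun /word_fun opprK subrK /=.
by rewrite -map_comp (nth_map false).
Qed.

Lemma input_fun_n (m : nat) z : z = m%:Z - base -> (m < n)%N -> input_fun z = bit true.
Proof.
move=> zE mn; rewrite (input_fun_nth zE) ?size_word; last by lia.
by rewrite nth_cat size_nseq mn nth_nseq mn.
Qed.

Lemma input_fun_after_n z : z = n%:Z - base -> input_fun z = bit false.
Proof.
move=> zE; rewrite (input_fun_nth zE) ?size_word; last by lia.
by rewrite nth_cat size_nseq ltnn subnn.
Qed.

Lemma input_fun_k (m : nat) z : z = n%:Z + 1 + m%:Z - base -> (m < k)%N ->
  input_fun z = bit true.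
Proof.
move=> zE mk; rewrite (@input_fun_nth (n + m.+1)) ?size_word; [|lia|lia].
by rewrite nth_cat size_nseq ifF ?addKn /= ?nth_cat ?size_nseq ?mk ?nth_nseq ?mk //; lia.
Qed.

Lemma input_fun_after_k z : z = -1 -> input_fun z = bit false.
Proof.
move=> zE; rewrite (@input_fun_nth (n + k.+1)) ?size_word; [|lia|lia].
rewrite nth_cat size_nseq ifF ?addKn /=; last by lia.
by rewrite nth_cat size_nseq ltnn subnn.
Qed.

Lemma input_fun_bits (i : nat) : (i < n * n)%N -> input_fun i = bit (nth false bits i).
Proof.
(* The index skips [n] ones and a 0, then [k] ones and a 0. *)
move=> i_lt; rewrite (@input_fun_nth (n + (k.+1 + i).+1)) ?size_word; [|lia|lia].
rewrite nth_cat size_nseq ifF ?addKn /=; last by lia.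
by rewrite nth_cat size_nseq ifF ?addSn -?addnS ?addKn //=; lia.
Qed.

Lemma input_fun_end : input_fun (n * n)%N = None.
Proof.
rewrite /input_fun /word_fun opprK nth_default ?if_same //.
by rewrite !size_map size_word; lia.
Qed.

Definition setup_input := upd input_fun (-1) None.

Definition setup_U (m : nat) (z : int) : sym :=
  if (n%:Z - m%:Z <= z) && (z < n%:Z) then cell false false else None.
(** This interval is one square to the right of that of [setup_U], which leaves square 0 for the
    mark. *)
Definition setup_D (m : nat) (z : int) : sym :=
  if (n%:Z - m%:Z < z) && (z <= n%:Z) then bit true else None.
Definition setup_C (m : nat) (z : int) : sym :=
  if (k%:Z - m%:Z <= z) && (z < k%:Z) then bit true else None.
Definition setup_D_mark := upd (setup_D n) 0 (bit false).

(* Tapes 1 to 3 are filled leftwards; these initial positions are chosen so that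
   every tape ends up with its origin at 0. *)
Definition init_fconfig : fconfig :=
  FConfig ReadN (input_fun, - base) (fun=> None, n%:Z - 1) (fun=> None, n%:Z)
    (fun=> None, k%:Z - 1).

Lemma iter_read_n (m : nat) : (m <= n)%N ->
  iter m fstep init_fconfig =
  FConfig ReadN (input_fun, m%:Z - base) (setup_U m, n%:Z - 1 - m%:Z)
    (setup_D m, n%:Z - m%:Z) (fun=> None, k%:Z - 1).
Proof.
elim: m => [|m IH] mn.
  rewrite /init_fconfig /=; congr FConfig; congr (_, _); try lia.
    by apply: functional_extensionality => z; rewrite /setup_U ifF //; lia.
  by apply: functional_extensionality => z; rewrite /setup_D ifF //; lia.
rewrite iterS IH 1?ltnW //= (@input_fun_n m) // eqxx /= /fwrite /=.
congr FConfig; congr (_, _); try lia.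
- by rewrite upd_same // (@input_fun_n m).
- apply: functional_extensionality => z; rewrite /setup_U /upd.
  case: eqP => [zE|nz]; first by rewrite ifT //; lia.
  by congr (if _ then _ else _); lia.
- apply: functional_extensionality => z; rewrite /setup_D /upd.
  case: eqP => [zE|nz]; first by rewrite ifT //; lia.
  by congr (if _ then _ else _); lia.
- by rewrite upd_same.
Qed.

Lemma step_read_n :
  iter n.+1 fstep init_fconfig =
  FConfig ReadK (input_fun, n%:Z + 1 - base) (setup_U n, 0) (setup_D_mark, 0)
    (fun=> None, k%:Z - 1).
Proof.
rewrite iterS iter_read_n //= input_fun_after_n //= /fwrite /=.
rewrite [upd (setup_U n) _ _]upd_same // subrr; congr FConfig; congr (_, _); try lia.
- by rewrite upd_same // input_fun_after_n.
- by rewrite upd_same.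
Qed.

Lemma iter_read_k (m : nat) : (m <= k)%N ->
  iter m fstep (FConfig ReadK (input_fun, n%:Z + 1 - base) (setup_U n, 0)
    (setup_D_mark, 0) (fun=> None, k%:Z - 1)) =
  FConfig ReadK (input_fun, n%:Z + 1 + m%:Z - base) (setup_U n, 0) (setup_D_mark, 0)
    (setup_C m, k%:Z - 1 - m%:Z).
Proof.
elim: m => [|m IH] mk.
  congr FConfig; congr (_, _); try lia.
  by apply: functional_extensionality => z; rewrite /setup_C ifF //; lia.
rewrite iterS IH 1?ltnW //= (@input_fun_k m) // eqxx /= /fwrite /=.
rewrite !(upd_same (f := setup_U n)) // !(upd_same (f := setup_D_mark)) //.
congr FConfig; congr (_, _); try lia.
- by rewrite upd_same // (@input_fun_k m).
- apply: functional_extensionality => z; rewrite /setup_C /upd.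
  case: eqP => [zE|nz]; first by rewrite ifT //; lia.
  by congr (if _ then _ else _); lia.
Qed.

Lemma iter_setup :
  iter (k.+1 + n.+1) fstep init_fconfig =
  cfg n setup_input setup_D_mark (setup_C k) (Fwd true) 0 (fun=> false) (fun=> false) 0 0 0.
Proof.
rewrite iterD step_read_n iterS iter_read_k //=.
have -> : n%:Z + 1 + k%:Z - base = -1 by rewrite /base; lia.
rewrite input_fun_after_k //= /fwrite /=.
rewrite !(upd_same (f := setup_U n)) // !(upd_same (f := setup_D_mark)) //.
rewrite !(upd_same (f := setup_C k)) //.
congr FConfig; congr (_, _); try lia.
apply: functional_extensionality => z; rewrite /setup_U /Ufun.
by congr (if _ then _ else _); lia.
Qed.

Definition bit_row (y z : nat) : bool := nth false bits (y * n + z).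

Lemma machine_run : (0 < n)%N ->
  let s := foldl (pass n bit_row) [::] (iota 0 n.+1) in
  fphase (iter (n.+1 * round_time n + (k.+1 + n.+1)) fstep init_fconfig) =
  Halt (k <= size s)%N.
Proof.
move=> n0 s; rewrite iterD iter_setup.
have [|||||||r' ->] := @iter_rounds n k bit_row setup_input setup_D_mark (setup_C k)
  n0 _ _ _ _ _ _ _ (fun=> false) n.+1 (leqnn _); last by rewrite eqxx.
- by rewrite /setup_input /upd eqxx.
- move=> y z yn zn; rewrite /setup_input /upd /= input_fun_bits //.
  by have := leq_mul2r n y.+1 n; rewrite yn orbT mulSn; lia.
- by rewrite /setup_input /upd /= input_fun_end.
- by [].
- move=> p pn; rewrite /setup_D_mark /upd /setup_D ifF; last by lia.
  by rewrite ifT //; lia.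
- move=> p pn; rewrite /setup_D_mark /upd /setup_D ifF; last by lia.
  by rewrite ifF //; lia.
- move=> p; rewrite /setup_C; case: ifP => pk; last by rewrite eqxx; lia.
  by rewrite (_ : (bit true == None) = false) //; lia.
Qed.
End Setup.

(** * Correctness *)

Section GreedyList.
Variables (T : finType) (G : sgraph T).
Implicit Types (l s : seq T) (v x y : T).

Definition greedy_add s y := if all (fun x => ~~ conflict G x y) s then y :: s else s.

Definition greedy l := foldl greedy_add [::] l.

Lemma greedy_rcons l y : greedy (rcons l y) = greedy_add (greedy l) y.
Proof. exact: foldl_rcons. Qed.

Lemma greedy_subset l : {subset greedy l <= l}.
Proof.
elim/last_ind: l => // l y IH v; rewrite greedy_rcons /greedy_add mem_rcons inE.
by case: ifP => _; rewrite ?inE; case: eqP => //= _; exact: IH.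
Qed.

Lemma greedy_uniq l : uniq l -> uniq (greedy l).
Proof.
elim/last_ind: l => // l y IH; rewrite rcons_uniq greedy_rcons /greedy_add.
case/andP=> yl /IH ul; case: ifP => //= _; rewrite ul andbT.
by apply: contra yl; exact: greedy_subset.
Qed.

Lemma greedy_compatible l :
  {in greedy l &, forall x y, x != y -> ~~ conflict G x y}.
Proof.
elim/last_ind: l => // l y IH; rewrite greedy_rcons /greedy_add.
case: ifP => // /allP ok u v; rewrite !inE.
case/predU1P=> [->|ul] /predU1P[->|vl] uv; rewrite ?eqxx // in uv *.
- by rewrite conflict_sym ok.
- exact: ok.
- exact: IH.
Qed.

(** A vertex is rejected because of a conflict with one chosen earlier, which has no larger degree
    since the list is sorted. *)
Lemma greedy_dominates l v : sorted (relpre (fun x => #|nbhd G x|) leq) l ->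
  v \in l -> v \notin greedy l ->
  exists2 x, x \in greedy l & conflict G x v && (#|nbhd G x| <= #|nbhd G v|)%N.
Proof.
have tr : transitive (relpre (fun x => #|nbhd G x|) leq) by move=> a b c; apply: leq_trans.
elim/last_ind: l => // l y IH; rewrite greedy_rcons /greedy_add mem_rcons inE.
rewrite -cats1 sorted_pairwise // pairwise_cat allrel1r -sorted_pairwise //.
case/and3P=> /allP ly sl _; case: ifP => [ok|/negbT/allPn[u us]].
  rewrite inE negb_or => /predU1P[->|vl]; first by rewrite eqxx.
  case/andP=> _ vs; have [x xs xv] := IH sl vl vs; exists x => //.
  by rewrite inE xs orbT.
rewrite negbK => uy /predU1P[-> _|vl]; last exact: IH.
by exists u; rewrite // uy; apply: (ly u); apply: greedy_subset.
Qed.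

(** One block per round of the machine; inside a block the order is that of the enumeration of [T],
    as for the rows of the matrix. *)
Definition by_degree (m : nat) : seq T :=
  flatten [seq [seq y <- enum T | #|nbhd G y| == d] | d <- iota 0 m].

Lemma by_degreeS m : by_degree m.+1 = by_degree m ++ [seq y <- enum T | #|nbhd G y| == m].
Proof. by rewrite /by_degree -addn1 iotaD map_cat flatten_cat /= cats0. Qed.

Lemma mem_by_degree m y : (y \in by_degree m) = (#|nbhd G y| < m)%N.
Proof.
elim: m => // m IH; rewrite by_degreeS mem_cat IH mem_filter mem_enum andbT.
by rewrite ltnS [RHS]leq_eqVlt orbC.
Qed.

Lemma by_degree_uniq m : uniq (by_degree m).
Proof.
elim: m => // m IH; rewrite by_degreeS cat_uniq IH filter_uniq ?enum_uniq // andbT.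
by apply/hasPn => y; rewrite mem_filter mem_by_degree => /andP[/eqP -> _]; rewrite ltnn.
Qed.

Lemma by_degree_sorted m : sorted (relpre (fun x => #|nbhd G x|) leq) (by_degree m).
Proof.
have tr : transitive (relpre (fun x => #|nbhd G x|) leq) by move=> a b c; apply: leq_trans.
elim: m => // m IH; rewrite by_degreeS sorted_pairwise // pairwise_cat -!sorted_pairwise //.
rewrite IH /=; apply/andP; split.
  apply/allrelP => x y; rewrite mem_by_degree mem_filter => xm /andP[/eqP ym _] /=.
  by rewrite ym ltnW.
have := filter_all (fun y => #|nbhd G y| == m) (enum T).
rewrite sorted_pairwise //; elim: (filter _ _) => //= x s IHs /andP[/eqP xm sm].
rewrite IHs // andbT; apply: sub_all sm => y /eqP ym /=.
by rewrite xm ym.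
Qed.

(** No vertex is its own neighbour, so all degrees are less than [#|T|] and every vertex is
    listed. *)
Lemma greedy_by_degree m : (#|T| <= m)%N ->
  greedy_packing G [set x in greedy (by_degree m)].
Proof.
move=> Tm; split=> [x y|v]; rewrite !inE; first exact: greedy_compatible.
have vm : v \in by_degree m.
  rewrite mem_by_degree; apply: leq_trans Tm; rewrite -cardsT; apply: proper_card.
  by apply/properP; split; [apply: subsetT | exists v; rewrite ?inE ?adj_irr].
move=> /(greedy_dominates (by_degree_sorted m) vm)[x xs h]; exists x => //.
by rewrite inE.
Qed.

End GreedyList.

Lemma nth_allpairs (A B C : Type) (f : A -> B -> C) a0 b0 c0 s t i j :
  (i < size s)%N -> (j < size t)%N ->
  nth c0 [seq f a b | a <- s, b <- t] (i * size t + j) = f (nth a0 s i) (nth b0 t j).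
Proof.
elim: s i => // a s IH [|i] /= is_ jt; rewrite nth_cat size_map.
  by rewrite jt (nth_map b0).
by rewrite ifF; [rewrite mulSn -addnA addKn IH | rewrite mulSn; lia].
Qed.

(** * The passes over the matrix compute the greedy packing *)

Section MatrixGreedy.
Variables (n : nat) (G : sgraph 'I_n).

Definition adjacency_bits : seq bool := [seq G i j | i <- enum 'I_n, j <- enum 'I_n].

Lemma size_adjacency_bits : size adjacency_bits = (n * n)%N.
Proof. by rewrite size_allpairs size_enum_ord. Qed.

Lemma bit_row_adj (x y : 'I_n) : bit_row n adjacency_bits x y = G x y.
Proof.
rewrite /bit_row -[X in (_ * X + _)%N](size_enum_ord n) (nth_allpairs _ x x) ?size_enum_ord //.
by rewrite !nth_ord_enum.
Qed.

Notation row := (bit_row n adjacency_bits).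

Lemma wt_degree (y : 'I_n) : wt row y n = #|nbhd G y|.
Proof.
rewrite /wt big_mkord cardsE -sum1_card [RHS]big_mkcond; apply: eq_bigr => z _.
by rewrite bit_row_adj -[z \in _]/(G y z); case: (G y z).
Qed.

(** A covered vertex at which row [y] has a 1 is precisely a common neighbour of [y] and some vertex
    of [s]. *)
Lemma disj_covered (s : seq 'I_n) (y : 'I_n) :
  disj row (covered row (map val s)) y n = all (fun x => ~~ conflict G x y) s.
Proof.
rewrite /disj -val_enum_ord all_map; apply/allP/allP => h x.
  move=> xs; apply/conflictP => -[z [xz yz]].
  have := h z; rewrite mem_enum /= bit_row_adj yz andbT => /(_ isT)/hasP[].
  by exists (val x); rewrite ?map_f // bit_row_adj.
move=> _; rewrite /= bit_row_adj; apply/negP => /andP[/hasP[_ /mapP[z zs ->]]].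
rewrite bit_row_adj => zx yx; have /negP[] := h z zs.
by apply/conflictP; exists x.
Qed.

(** Vertices of another degree leave the list of chosen vertices unchanged, so they can be filtered
    out beforehand. *)
Lemma foldl_visit d (s l : seq 'I_n) :
  foldl (visit n row d) (map val s) (map val l) =
  map val (foldl (greedy_add G) s [seq y <- l | #|nbhd G y| == d]).
Proof.
elim: l s => //= y l IH s.
have -> : visit n row d (map val s) (val y) =
    map val (if #|nbhd G y| == d then greedy_add G s y else s).
  rewrite /visit /takes disj_covered wt_degree andbC /greedy_add.
  by case: eqP => // _; case: (all _ _).
by rewrite IH; case: eqP.
Qed.

Lemma foldl_pass m :
  foldl (pass n row) [::] (iota 0 m) = map val (greedy G (by_degree G m)).
Proof.
elim: m => // m IH; rewrite -[in LHS]addn1 iotaD foldl_cat IH /= add0n.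
by rewrite /pass -val_enum_ord foldl_visit by_degreeS /greedy foldl_cat.
Qed.

(** The greedy packing is itself a witness for one direction; its maximality gives the other. *)
Lemma size_greedy_maximum k : split_graph G -> claw_free G ->
  (k <= size (greedy G (by_degree G n.+1)))%N <->
  exists S : {set 'I_n}, open_packing G S /\ (k <= #|S|)%N.
Proof.
move=> splitG clawG; set s := greedy _ _.
have gS : greedy_packing G [set x in s] by apply: greedy_by_degree; rewrite card_ord.
have cS : #|[set x in s]| = size s.
  by rewrite cardsE; apply/card_uniqP/greedy_uniq/by_degree_uniq.
rewrite -cS; split=> [ks|[S' [pS' kS']]].
  by exists [set x in s]; split=> //; apply/open_packingP; case: gS.
exact: leq_trans kS' (greedy_packing_maximum splitG clawG gS pS').
Qed.

End MatrixGreedy.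

(** * Initial configuration, running time and conclusion *)

Lemma init_fconfig_rep n k bits :
  crep (init_fconfig n k bits)
    (init_config op_machine (nseq n true ++ false :: nseq k true ++ false :: bits)).
Proof.
split=> // i; rewrite /init_config /=; case: eqP => [->|i0].
  exact: represents_input.
(* Tapes 1 to 3 start blank, so any initial head position may be assigned to them. *)
have blank p : represents ((fun=> None, p) : tp) (input_tape [::]).
  by split=> // j; rewrite /= nth_nil.
by case: i i0 => [[|[|[|[|i]]]]] hi i0 //=; case: i0; apply: val_inj.
Qed.

Lemma crep_iter t a c : crep a c -> crep (iter t fstep a) (iter t (@step op_machine) c).
Proof. by move=> ac; elim: t => //= t IH; apply: crep_step. Qed.

(** Here [s] is the length of the encoding. At most [s] rounds of at most [3 * s * s] steps,
    together with the set-up, take at most [4 * s ^ 3] steps, and a further factor [s ^ 2] absorbs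
    the constant. *)
Lemma time_bound n k : (0 < k)%N -> (k <= n)%N ->
  (n.+1 * round_time n + (k.+1 + n.+1) <= ((n + k).+2 + n * n) ^ 5)%N.
Proof.
move=> k0 kn; set s := ((n + k).+2 + n * n)%N.
have rt : (round_time n <= 3 * s * s)%N by rewrite /round_time /s; nia.
have a : (n.+1 * round_time n <= s * (3 * s * s))%N.
  by apply: leq_mul => //; rewrite /s; lia.
have b : (k.+1 + n.+1 <= s)%N by rewrite /s; lia.
have c : (4 <= s)%N by rewrite /s; lia.
apply: leq_trans (leq_add a b) _.
have e : (s * (3 * s * s) + s <= 4 * (s * s * s))%N by nia.
apply: leq_trans e _.
rewrite (_ : s ^ 5 = (s * s) * (s * s * s))%N; last by rewrite !expnS expn0; lia.
by rewrite leq_mul2r; apply/orP; right; nia.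
Qed.

Theorem theorem11 :
  poly_time_solvable_on (P := open_packing_problem)
    (fun x : op_instance => split_graph (op_graph x) /\ claw_free (op_graph x)).
Proof.
exists op_machine, ('X^5) => -[n G k k_bounds] /= [splitG clawG].
have /andP[k0 kn] := k_bounds.
(* This boolean is the answer that the machine computes, the size of its list of chosen vertices
   being the head position on tape 3. *)
exists (k <= size (greedy G (by_degree G n.+1)))%N; split; last first.
  exact: size_greedy_maximum.
exists (n.+1 * round_time n + (k.+1 + n.+1))%N.
  rewrite hornerXn /op_encode /= (size_word _ (size_adjacency_bits G)).
  exact: time_bound.
have n0 : (0 < n)%N by apply: leq_trans kn.
have := crep_iter (n.+1 * round_time n + (k.+1 + n.+1))
  (init_fconfig_rep n k (adjacency_bits G)).
case=> -> _; rewrite (machine_run k (size_adjacency_bits G) n0).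
by rewrite foldl_pass size_map.
Qed.
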